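(* In $\mathcal{R}$-Wythoff, a position $(a,b)$ with $a \leq b$ has Sprague-Grundy value $1$ if and only if $(a,b)$ belongs to the set \[\{(2,2), (4,6)\} \cup \{(\lfloor \phi n \rfloor - 1, \lfloor \phi n \rfloor +n-1) : n \geq 1, n \neq 2\},\] where $\phi=(1+\sqrt5)/2$.
   Context: A position is an unordered pair $(a,b)$ of nonnegative integers (pile sizes). $\mathcal{R}$-Wythoff: a move either removes a positive number of tokens from the larger pile (or from either pile if both piles have equal size), or removes the same positive number of tokens from both piles. The Sprague-Grundy function is defined by $\mathcal{G}(p)=\mathrm{mex}\{\mathcal{G}(q): q \text{ reachable from } p \text{ in one move}\}$, where $\mathrm{mex}(S)$ is the smallest nonnegative integer not in $S$ and $\mathrm{mex}\{\}=0$. *)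

(* Defs.v *)
From mathcomp Require Import all_boot all_order all_algebra.
From mathcomp Require Import classical_sets reals.
Import Order.TTheory GRing.Theory Num.Theory.

Set Implicit Arguments.
Unset Strict Implicit.
Unset Printing Implicit Defensive.

Lemma mex_exists (s : seq nat) : exists n, n \notin s.
Proof.
exists (\max_(i <- s) i).+1; apply/negP => /leq_bigmax_seq.
by move=> /(_ predT id isT); rewrite ltnn.
Qed.

Definition mex (s : seq nat) : nat := ex_minn (mex_exists s).

(* An unordered pair of piles is represented by either of its two orderings:  *)
(* the rules below are symmetric, and sgC shows that the Sprague-Grundy value *)
(* does not depend on the ordering chosen.                                    *)
Definition position : Type := (nat * nat)%type.

(* A pile is eligible for a one-pile move when it is at least as large as the *)
(* other one, so both piles are eligible when they have equal size.           *)
Definition options (p : position) : seq position :=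
  let: (a, b) := p in
     [seq (a - k, b) | k <- iota 1 a & b <= a]
  ++ [seq (a, b - k) | k <- iota 1 b & a <= b]
  ++ [seq (a - k, b - k) | k <- iota 1 (minn a b)].

(* Every option has strictly fewer tokens than p, so fuel exceeding the total *)
(* number of tokens is enough; sgE is the defining equation of the function.  *)
Fixpoint sg_rec (fuel : nat) (p : position) : nat :=
  if fuel is fuel'.+1 then mex [seq sg_rec fuel' q | q <- options p] else 0.

Definition sg (p : position) : nat := sg_rec (p.1 + p.2).+1 p.

Lemma options_lt (p q : position) :
  q \in options p -> q.1 + q.2 < p.1 + p.2.
Proof.
case: p => a b; rewrite /options !mem_cat.
case/or3P => /mapP[k]; rewrite ?mem_filter mem_iota add1n ltnS.
- case/and3P=> _ k0 ka ->/=; rewrite ltn_add2r.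
  by rewrite ltn_subrL k0 (leq_trans k0 ka).
- case/and3P=> _ k0 kb ->/=; rewrite ltn_add2l.
  by rewrite ltn_subrL k0 (leq_trans k0 kb).
- rewrite leq_min => /and3P[k0 ka kb] ->/=.
  rewrite -addSn leq_add ?leq_subr//.
  by rewrite ltn_subrL k0 (leq_trans k0 ka).
Qed.

Lemma sg_rec_fuel (m n : nat) (p : position) :
  p.1 + p.2 < m -> p.1 + p.2 < n -> sg_rec m p = sg_rec n p.
Proof.
elim: m n p => [//|m IH] [//|n] p; rewrite !ltnS => pm pn /=.
congr mex; apply/eq_in_map => q /options_lt qp.
by apply: IH; apply: leq_trans qp _.
Qed.

Lemma sgE (p : position) : sg p = mex [seq sg q | q <- options p].
Proof.
rewrite {1}/sg /=; congr mex; apply/eq_in_map => q /options_lt qp.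
exact: sg_rec_fuel.
Qed.

Lemma eq_mex (s t : seq nat) : s =i t -> mex s = mex t.
Proof. by move=> st; apply: eq_ex_minn => n; rewrite st. Qed.

Definition swap (p : position) : position := (p.2, p.1).

Lemma options_swap (p : position) :
  options (swap p) =i map swap (options p).
Proof.
case: p => a b q; rewrite /swap /options /= !map_cat -!map_comp /comp /=.
by rewrite !mem_cat minnC orbCA.
Qed.

Lemma sgC (a b : nat) : sg (a, b) = sg (b, a).
Proof.
suff H n p : p.1 + p.2 < n -> sg (swap p) = sg p.
  exact: (H (b + a).+1 (b, a)).
elim: n p => [//|n IH] p pn; rewrite (sgE (swap p)) (sgE p).
rewrite (@eq_mex _ (map sg (map swap (options p)))); last first.
  by apply: eq_mem_map; exact: options_swap.
rewrite -map_comp; congr mex; apply/eq_in_map => q /options_lt qp.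
by apply: IH; apply: leq_trans qp _.
Qed.

Local Open Scope ring_scope.
Local Open Scope classical_set_scope.

Definition phi (R : realType) : R := (1 + Num.sqrt 5) / 2.

(* Num.floor is integer-valued; the coordinates are compared in int, so that  *)
(* no truncated subtraction is involved.                                      *)
Definition beatty_positions (R : realType) : set position :=
  [set p | exists n : nat,
     [/\ (1 <= n)%N, n <> 2%N,
         p.1%:Z = Num.floor (phi R * n%:R) - 1
       & p.2%:Z = Num.floor (phi R * n%:R) + n%:Z - 1]].

(* Main.v *)
(** For each difference d of the pile sizes exactly one position has value 0 and
    exactly one has value 1, with smaller piles [wythoff d], the floor of
    phi * d, and [one_pile d] respectively.  The values 0 and 1 are recognised by
    independence and absorption, which follow from Beatty's theorem: the positive
    integers are partitioned by floor (phi * n) and floor (phi * n) + n, n >= 1.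
    Since u <= phi * n iff u^2 <= u n + n^2, that partition is integer arithmetic
    plus the irrationality of phi. *)
Require Import Defs.
From mathcomp Require Import all_boot all_order all_algebra.
From mathcomp Require Import classical_sets reals.
From mathcomp Require Import zify ring lra.
Import Order.TTheory GRing.Theory Num.Theory.

Local Open Scope classical_set_scope.

Set Implicit Arguments.
Unset Strict Implicit.
Unset Printing Implicit Defensive.

(** * Recognising the Grundy values 0 and 1 *)

Lemma mex_eq0 (s : seq nat) : (mex s == 0%N) = (0%N \notin s).
Proof.
rewrite /mex; case: ex_minnP => m ms min_m; apply/eqP/idP => [<- //|s0].
by have := min_m _ s0; lia.
Qed.

Lemma mex_eq1 (s : seq nat) : (mex s == 1%N) = (0%N \in s) && (1%N \notin s).
Proof.
rewrite /mex; case: ex_minnP => m ms min_m; apply/eqP/andP => [m1|[s0 s1]].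
  rewrite -m1 ms; split=> //; apply/negPn/negP => /min_m; lia.
have := min_m _ s1; case: m ms {min_m} => [|m _]; last by lia.
by rewrite s0.
Qed.

Definition on_graph (f : nat -> nat) (p : position) : bool :=
  minn p.1 p.2 == f (maxn p.1 p.2 - minn p.1 p.2)%N.

Lemma on_graph_le (f : nat -> nat) (a b : nat) :
  (a <= b)%N -> on_graph f (a, b) = (a == f (b - a)%N).
Proof. by move=> ab; rewrite /on_graph /= (minn_idPl ab) (maxn_idPr ab). Qed.

Lemma on_graphC (f : nat -> nat) (a b : nat) :
  on_graph f (a, b) = on_graph f (b, a).
Proof. by rewrite /on_graph /= minnC maxnC. Qed.

(** The cases are the kinds of move: a diagonal move keeps the difference; shrinking the larger pile
    either leaves it at least [a] or brings it down to [f d < a]. *)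
Lemma reach_graphP (f : nat -> nat) (a b : nat) : (a <= b)%N ->
  has (on_graph f) (options (a, b)) <->
  [\/ (f (b - a) < a)%N,
      exists2 d, (d < b - a)%N & a = f d
    | exists2 d, (0 < d)%N & a = (f d + d)%N].
Proof.
move=> ab; split.
  move=> /hasP[q]; rewrite /options !mem_cat => /or3P[] /mapP[k];
    rewrite ?mem_filter mem_iota => hk ->.
  - rewrite on_graph_le; last by lia.
    move=> /eqP e; apply: Or33; exists k; first by lia.
    have -> : k = (b - (a - k))%N by lia.
    by rewrite -e; lia.
  - case: (leqP a (b - k)) => abk.
      rewrite on_graph_le// => /eqP e; apply: Or32.
      by exists (b - k - a)%N; first by lia.
    rewrite on_graphC on_graph_le; last by lia.
    move=> /eqP e; apply: Or33; exists (a - (b - k))%N; first by lia.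
    by rewrite -e; lia.
  - rewrite on_graph_le; last by lia.
    move=> /eqP e; apply: Or31.
    have -> : (b - a = b - k - (a - k))%N by lia.
    by rewrite -e; lia.
move=> H; apply/hasP; rewrite /options; case: H => [fa|[d db ad]|[d d0 ad]].
- exists (f (b - a), f (b - a) + (b - a))%N; last first.
    by rewrite on_graph_le ?leq_addr// addKn.
  rewrite !mem_cat; apply/or3P/Or33/mapP.
  exists (a - f (b - a))%N; first by rewrite mem_iota; lia.
  by congr pair; lia.
- exists (a, a + d)%N; last by rewrite on_graph_le ?leq_addr// addKn ad.
  rewrite !mem_cat; apply/or3P/Or32/mapP.
  exists (b - (a + d))%N; first by rewrite mem_filter mem_iota; lia.
  by congr pair; lia.
- exists (a, f d)%N; last first.
    by rewrite on_graphC on_graph_le ad ?leq_addr// addKn.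
  rewrite !mem_cat; apply/or3P/Or32/mapP.
  exists (b - f d)%N; first by rewrite mem_filter mem_iota; lia.
  by congr pair; lia.
Qed.

Lemma graph_independent (f : nat -> nat) (a b : nat) :
  injective f -> (forall d e, (0 < e)%N -> f d <> (f e + e)%N) ->
  (a <= b)%N -> on_graph f (a, b) -> ~~ has (on_graph f) (options (a, b)).
Proof.
move=> finj fdisj ab; rewrite on_graph_le// => /eqP e.
apply/negP => /(reach_graphP f ab)[|[d db ad]|[d d0 ad]]; first by lia.
  by have := finj _ _ (etrans (esym e) ad); lia.
exact: fdisj d0 (etrans (esym e) ad).
Qed.

(** The hypotheses are the mex recursion restricted to the values 0 and 1, so induction on the
    number of tokens applies. *)
Lemma sg_values01 (P0 P1 : pred position) :
  (forall p, P0 p = ~~ has P0 (options p)) ->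
  (forall p, P1 p = has P0 (options p) && ~~ has P1 (options p)) ->
  forall p, ((sg p == 0%N) = P0 p) * ((sg p == 1%N) = P1 p).
Proof.
move=> P0E P1E p; have [n] := ubnP (p.1 + p.2)%N.
elim: n p => [//|n IH] p pn.
have sg_in c P : (forall q, q \in options p -> (sg q == c) = P q) ->
    (c \in [seq sg q | q <- options p]) = has P (options p).
  move=> cP; rewrite -has_pred1 has_map; apply: eq_in_has => q qp /=.
  exact: cP.
have lt_n q : q \in options p -> (q.1 + q.2 < n)%N.
  by move=> /options_lt qp; apply: leq_trans qp _.
rewrite sgE mex_eq0 mex_eq1 P0E P1E.
by rewrite (sg_in _ P0) ?(sg_in _ P1)// => q /lt_n /IH[].
Qed.

(** * Beatty's theorem for phi in integer arithmetic *)

Lemma wythoff_ex (n : nat) : exists u : nat, (u * u <= u * n + n * n)%N.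
Proof. by exists 0%N. Qed.

Lemma wythoff_bound (n u : nat) : (u * u <= u * n + n * n -> u <= n.*2)%N.
Proof. by nia. Qed.

Definition wythoff (n : nat) : nat := ex_maxn (wythoff_ex n) (@wythoff_bound n).

Lemma leq_wythoff (u n : nat) :
  (u <= wythoff n)%N = (u * u <= u * n + n * n)%N.
Proof.
rewrite /wythoff; case: ex_maxnP => m m_ok max_m.
apply/idP/idP; last exact: max_m.
(* The condition is downward closed: u(u - n) <= n^2 is clear for u <= n, and the left side
   increases beyond n. *)
by move=> um; case: (leqP u n) => un; nia.
Qed.

(* Descent: if u / n = phi then n / (u - n) = phi. *)
Lemma golden_irrational (u n : nat) : (u * u = u * n + n * n -> u = 0)%N.
Proof.
have [k] := ubnP u; elim: k u n => [//|k IH] u n uk e.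
have [v uE] : exists v, (u = n + v)%N by exists (u - n)%N; nia.
have e' : (n * n = n * v + v * v)%N by rewrite uE in e; lia.
case: (posnP v) => [v0|v0]; first by nia.
have n0 := IH n v ltac:(lia) e'.
by nia.
Qed.

Lemma wythoff_homo (m n : nat) : (m < n)%N -> (wythoff m < wythoff n)%N.
Proof.
move=> /subnKC <-; have := leqnn (wythoff m); rewrite !leq_wythoff => w_ok.
by have := wythoff_bound w_ok; nia.
Qed.

Lemma wythoff_inj : injective wythoff.
Proof.
by move=> m n e; case: (ltngtP m n) => // /wythoff_homo; rewrite e ltnn.
Qed.

(** Take the least n with [u <= wythoff n]. If u < [wythoff n], then phi(n - 1) < u and u + 1 < phi
    n; for k = u - (n - 1) this gives n - 1 < phi k < n, hence u = [wythoff k + k]. *)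
Lemma wythoff_cover (u : nat) : (0 < u)%N ->
  exists2 n, (0 < n)%N & u = wythoff n \/ u = (wythoff n + n)%N.
Proof.
move=> u0; have ex : exists n, (u <= wythoff n)%N.
  by exists u; rewrite leq_wythoff; nia.
case: (ex_minnP ex) => n un min_n.
have n0 : (0 < n)%N by rewrite leq_wythoff in un; nia.
have nu : (n <= u)%N by apply: min_n; rewrite leq_wythoff; nia.
have pn : (wythoff n.-1 < u)%N.
  by rewrite ltnNge; apply/negP => /min_n; lia.
case: (ltngtP u (wythoff n)) un => // [un _|un _]; last by exists n => //; left.
(* Irrationality gives the strict inequality u + 1 < phi n. *)
have strict : (u.+1 * u.+1 <> u.+1 * n + n * n)%N by move/golden_irrational.
case: n un n0 nu pn strict {min_n} => // p un _ /subnKC uE pn strict.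
move: un pn strict; rewrite -uE; move: (u - p.+1)%N => m /= un pn strict.
exists m.+1 => //; right.
have -> : wythoff m.+1 = p; last by lia.
move: un pn; rewrite leq_wythoff ltnNge leq_wythoff => un pn.
apply/eqP; rewrite eqn_leq andbC leq_wythoff; apply/andP; split; first by lia.
by rewrite leqNgt leq_wythoff; lia.
Qed.

(** Let c be the common value. If n <= [wythoff m], then m >= n / phi and c >= n + n / phi = phi n,
    against c < phi n. Otherwise n > phi m and c + 1 <= n + m < phi n, against the maximality of
    [wythoff n]. *)
Lemma wythoff_disjoint (n m : nat) :
  (0 < m)%N -> wythoff n <> (wythoff m + m)%N.
Proof.
move=> m0 e.
have lt_n := ltnn (wythoff n); have le_n := leqnn (wythoff n).
rewrite !leq_wythoff in lt_n le_n.
have strict : (wythoff n * wythoff n <> wythoff n * n + n * n)%N.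
  by move/golden_irrational; lia.
case: (leqP n (wythoff m)) => nm.
  have := nm; rewrite leq_wythoff => nm2.
  move: nm e => /subnKC <-; move: (_ - n)%N => k e.
  by rewrite e in le_n strict; nia.
have := nm; rewrite ltnNge leq_wythoff => nm2.
case: (leqP n (wythoff n)) => [/subnKC|] nu; last by nia.
move: e lt_n; rewrite -nu; move: (_ - n)%N => k e lt_n.
by nia.
Qed.

Lemma wythoff_values :
  (wythoff 0 = 0) * (wythoff 1 = 1) * (wythoff 2 = 3) * (wythoff 3 = 4) *
  (wythoff 4 = 6).
Proof. by do !split; apply/eqP; rewrite eqn_leq leqNgt !leq_wythoff. Qed.

Lemma wythoff_gt0 (n : nat) : (0 < n)%N -> (0 < wythoff n)%N.
Proof. by move=> /wythoff_homo; apply: leq_ltn_trans. Qed.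

(** * The smaller piles of the positions of value 1 *)

(** Differences 0 and 2 carry the exceptional positions (2,2) and (4,6); elsewhere [wythoff d] is
    positive, so [.-1] does not truncate. *)
Definition one_pile (d : nat) : nat :=
  if d == 0%N then 2%N else if d == 2%N then 4%N else (wythoff d).-1.

Variant one_pile_spec (d : nat) : nat -> Prop :=
| OnePile0 of d = 0%N : one_pile_spec d 2
| OnePile2 of d = 2%N : one_pile_spec d 4
| OnePileWythoff u of (0 < d)%N & d <> 2%N & wythoff d = u.+1 :
    one_pile_spec d u.

Lemma one_pileP (d : nat) : one_pile_spec d (one_pile d).
Proof.
rewrite /one_pile; case: eqP => [|/eqP]; first exact: OnePile0.
rewrite -lt0n => d0; case: eqP => [|d2]; first exact: OnePile2.
by apply: OnePileWythoff => //; rewrite prednK// wythoff_gt0.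
Qed.

(** A clash with the exceptional values 2 or 4 needs [wythoff d] to be 3 = [wythoff 2], where d = 2
    is excluded, or 5 = [wythoff 2 + 2], which Beatty rules out. *)
Lemma one_pile_inj : injective one_pile.
Proof.
have w2 d : wythoff d = 3%N -> d = 2%N.
  by move=> dE; apply: wythoff_inj; rewrite wythoff_values.
have w5 d : wythoff d <> 5%N.
  by have := @wythoff_disjoint d 2 isT; rewrite wythoff_values.
move=> d e; case: one_pileP => [->|->|u d0 d2 dE];
  case: one_pileP => [->|->|v e0 e2 eE] // uv; subst.
- by case: e2; exact: w2.
- by case: (w5 e).
- by case: d2; exact: w2.
- by case: (w5 d).
- by apply: wythoff_inj; rewrite dE.
Qed.

(** Adding 1 to both sides reduces the generic case to [wythoff_disjoint]. *)
Lemma one_pile_disjoint (d e : nat) :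
  (0 < e)%N -> one_pile d <> (one_pile e + e)%N.
Proof.
move=> e0; case: (one_pileP e) => [e1|->|v _ e2 eE]; first by lia.
  case: one_pileP => [//|//|u _ _ dE] ue.
  (* Here [wythoff d] would be 7 = [wythoff 3 + 3]. *)
  by apply: (@wythoff_disjoint d 3); rewrite // dE ue wythoff_values.
have eq_e c : c = (v + e)%N -> c.+1 = (wythoff e + e)%N by rewrite eE => ->.
case: one_pileP => [_ /eq_e|_ /eq_e|u _ _ dE /eq_e].
- by have := @wythoff_disjoint 2 e e0; rewrite wythoff_values.
- by case: (ltngtP e 2) e2 => // e2 _; have := wythoff_homo e2;
    rewrite wythoff_values; lia.
- by rewrite -dE; exact: wythoff_disjoint.
Qed.

(** * Absorption and the Grundy values *)

Lemma wythoff_absorbing (a b : nat) : (a <= b)%N ->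
  on_graph wythoff (a, b) \/ has (on_graph wythoff) (options (a, b)).
Proof.
move=> ab; rewrite on_graph_le// reach_graphP//.
have [n aE] : exists n, a = wythoff n \/ ((0 < n)%N /\ a = (wythoff n + n)%N).
  case: (posnP a) => [->|/wythoff_cover[n n0 [->|->]]].
  - by exists 0%N; left; rewrite wythoff_values.
  - by exists n; left.
  - by exists n; right.
case: aE => [aE|[n0 aE]]; last by right; apply: Or33; exists n.
case: (ltngtP n (b - a)) => [nd|nd|nd]; last by left; rewrite -nd aE.
  by right; apply: Or32; exists n.
by right; apply: Or31; rewrite [X in (_ < X)%N]aE; exact: wythoff_homo.
Qed.

Lemma one_pile_absorbing (a b : nat) : (a <= b)%N ->
  [\/ on_graph wythoff (a, b), on_graph one_pile (a, b)
    | has (on_graph one_pile) (options (a, b))].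
Proof.
move=> ab; rewrite !on_graph_le//; have reach := (reach_graphP one_pile ab).2.
have [n aE] : exists n,
    a = one_pile n \/ ((0 < n)%N /\ a = (one_pile n + n)%N).
  (* Beatty's partition is shifted by one; index 2 covers a = 2 and a = 4, the two exceptional
     smaller piles. *)
  have [//|n n0 aE] := @wythoff_cover a.+1.
  case: (eqVneq n 2%N) aE => [->|/eqP n2].
    rewrite wythoff_values => -[] [->]; first by exists 0%N; left.
    by exists 2%N; left.
  have -> : wythoff n = (one_pile n).+1 by case: one_pileP => //; lia.
  by case=> [[->]|[->]]; exists n; [left | right].
case: aE => [aE|[n0 aE]]; last by apply/Or33/reach/Or33; exists n.
case: (ltngtP n (b - a)) => [nd|nd|nd]; last by apply: Or32; rewrite -nd aE.
  by apply/Or33/reach/Or32; exists n.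
(* The diagonal move works here except from (0,0) and (3,5), which lie on the graph of [wythoff]. *)
suff [lt_a|eq_a] : (one_pile (b - a) < a)%N \/ a = wythoff (b - a).
- by apply/Or33/reach/Or31.
- by apply/Or31/eqP.
rewrite [X in (_ < X)%N \/ _]aE [X in _ \/ X = _]aE; move: (b - a)%N nd => d nd.
case: (one_pileP n) => [|n2|u n0 n2 nE]; first by lia.
  left; case: one_pileP => [//|//|v _ _]; first by lia.
  by have := @wythoff_homo d 2; rewrite wythoff_values -n2 => /(_ nd); lia.
have le_w k : (k <= n)%N -> (wythoff k <= wythoff n)%N.
  by rewrite leq_eqVlt => /predU1P[->//|/wythoff_homo/ltnW].
case: one_pileP => [d0|d2|v _ _ dE].
- case: (eqVneq n 1%N) => [n1|n1].
    by right; move: nE; rewrite d0 n1 !wythoff_values => -[].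
  by left; have := le_w 3%N; rewrite nE wythoff_values; lia.
- case: (eqVneq n 3%N) => [n3|n3].
    by right; move: nE; rewrite d2 n3 !wythoff_values => -[].
  by left; have := le_w 4%N; rewrite nE wythoff_values; lia.
- by left; have := wythoff_homo nd; rewrite nE dE.
Qed.

Lemma on_wythoff_one_pile (p : position) :
  on_graph wythoff p -> ~~ on_graph one_pile p.
Proof.
rewrite /on_graph => /eqP mE; rewrite [X in X == _]mE.
case: one_pileP => [->|->|u _ _ ->].
- by rewrite wythoff_values.
- by rewrite wythoff_values.
- by rewrite eqn_leq ltnn.
Qed.

Lemma has_options_swap (f : nat -> nat) (p : position) :
  has (on_graph f) (options (swap p)) = has (on_graph f) (options p).
Proof.
rewrite (eq_has_r (options_swap p)) has_map; apply: eq_has => -[a b].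
exact: on_graphC.
Qed.

Lemma ordered_position (P : position -> Prop) :
  (forall a b, (a <= b)%N -> P (a, b)) -> (forall p, P (swap p) -> P p) ->
  forall p, P p.
Proof.
move=> P_le P_swap [a b]; case: (leqP a b) => [|/ltnW] ab; first exact: P_le.
by apply: P_swap; exact: P_le.
Qed.

Lemma sg_eq1 (p : position) : (sg p == 1%N) = on_graph one_pile p.
Proof.
have P0E q : on_graph wythoff q = ~~ has (on_graph wythoff) (options q).
  elim/ordered_position: q => [a b ab|[a b]]; last first.
    by rewrite has_options_swap [on_graph _ (swap _)]on_graphC.
  apply/idP/idP => [|/negP nr].
    by apply: graph_independent => //;
      [exact: wythoff_inj | exact: wythoff_disjoint].
  by case: (wythoff_absorbing ab).
apply: (sg_values01 P0E _ p).2 => q.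
elim/ordered_position: q => [a b ab|[a b]]; last first.
  by rewrite !has_options_swap [on_graph _ (swap _)]on_graphC.
(* By [P0E], an option of value 0 exists exactly off the graph of [wythoff]. *)
rewrite -[has _ _ in RHS]negbK -P0E; apply/idP/andP => [on1|[n0 nr]].
  split; first by apply: contraL on1 => /on_wythoff_one_pile.
  by apply: graph_independent => //;
    [exact: one_pile_inj | exact: one_pile_disjoint].
by case: (one_pile_absorbing ab) => //; rewrite ?(negPf n0) ?(negPf nr).
Qed.

(** * Back to the real number phi *)

Local Open Scope ring_scope.

Lemma floor_phi (R : realType) (n : nat) :
  Num.floor (phi R * n%:R) = (wythoff n)%:Z.
Proof.
have s5 : (Num.sqrt 5 : R) ^+ 2 = 5 by rewrite sqr_sqrtr.
have s1 : 1 < Num.sqrt 5 :> R.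
  by rewrite -[X in X < _]sqrtr1 ltr_sqrt// ltr1n.
have phi_sq : phi R * phi R = phi R + 1 by rewrite /phi; nra.
have phi1 : 1 < phi R by rewrite /phi; lra.
have le_phi u : (u%:R <= phi R * n%:R) = (u <= wythoff n)%N.
  rewrite leq_wythoff -(@ler_nat R) natrD !natrM.
  set x : R := u%:R; set y : R := n%:R.
  rewrite -[LHS]subr_ge0 -[RHS]subr_ge0.
  (* The second factor comes from the conjugate root 1 - phi; it is positive unless x = y = 0, so
     the first decides the sign. *)
  have -> : x * y + y * y - x * x = (phi R * y - x) * ((phi R - 1) * y + x).
    by ring: phi_sq.
  have [n0|n0] := posnP n; last first.
    have y0 : 0 < y by rewrite ltr0n.
    have x0 : 0 <= x by exact: ler0n.
    by rewrite pmulr_lge0//; nra.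
  rewrite /y n0 !mulr0 !add0r; case: u @x => [|u] x.
    by rewrite /x oppr0 mul0r.
  have x0 : 0 < x by rewrite ltr0n.
  by rewrite pmulr_lge0.
apply/eqP; rewrite floor_eq; apply/andP; split.
  by rewrite -pmulrn le_phi.
by rewrite -PoszD addn1 -pmulrn ltNge le_phi ltnn.
Qed.

Theorem theorem2p4 (R : realType) (a b : nat) (hab : (a <= b)%N) :
  sg (a, b) = 1%N <->
  ([set (2, 2)%N; (4, 6)%N] `|` beatty_positions R) (a, b).
Proof.
rewrite (rwP eqP) sg_eq1 on_graph_le// -(rwP eqP); split.
  case: one_pileP => [d0 a2|d2 a4|u d0 d2 dE au].
  - by left; left; congr pair; lia.
  - by left; right; congr pair; lia.
  - by right; exists (b - a)%N; split=> //=; rewrite floor_phi; lia.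
case=> [[] [-> ->] //|[n [n0 n2 /=]]]; rewrite floor_phi => aE bE.
have -> : (b - a = n)%N by lia.
by case: one_pileP => [|//|u _ _]; lia.
Qed.
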